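(* Let $G$ be a locally compact Hausdorff group that is second-countable and unimodular, with Haar measure $\mu_G$. Let $\Gamma$ be a discrete subgroup of $G$. Let $\varphi\in L^1(G)$. Suppose that there exists a Borel set $C\subseteq G$ with the following properties: (C1) $\int_C|\varphi|\,d\mu_G>\int_{G\setminus C}|\varphi|\,d\mu_G$; (C2) $CC^{-1}\cap\Gamma=\{1_G\}$. Then $P_\Gamma\varphi\neq0$ in $L^1(\Gamma\backslash G)$.
   Context: $\mu_{\Gamma\backslash G}$ is the unique Radon measure on $\Gamma\backslash G$ satisfying $\int_{\Gamma\backslash G}\sum_{\gamma\in\Gamma}f(\gamma g)\,d\mu_{\Gamma\backslash G}(g)=\int_Gf\,d\mu_G$ for all $f\in C_c(G)$, and $L^1(\Gamma\backslash G)$ is taken with respect to it. For $\varphi\in L^1(G)$, the Poincaré series is $(P_\Gamma\varphi)(g)=\sum_{\gamma\in\Gamma}\varphi(\gamma g)$; it converges absolutely for almost every $g\in G$ and defines an element of $L^1(\Gamma\backslash G)$. $CC^{-1}=\{cd^{-1}:c,d\in C\}$. *)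

(* Defs.v *)
From HB Require Import structures.
From mathcomp Require Import all_boot all_order all_algebra complex.
From mathcomp Require Import all_classical all_reals all_analysis.
Import Order.TTheory GRing.Theory Num.Theory.
Import numFieldNormedType.Exports.
Set Implicit Arguments.
Unset Strict Implicit.
Unset Printing Implicit Defensive.

Local Open Scope classical_set_scope.
Local Open Scope ring_scope.
Local Open Scope complex_scope.

(* [point] is an arbitrary element: it is required only because the measurable
   types of the library are pointed. *)
HB.mixin Record isTopologicalGroup G of PointedTopological G & Group G := {
  mulg_continuous : continuous (fun x : G * G => (x.1 * x.2)%g : G) ;
  invg_continuous : continuous (fun x : G => (x^-1)%g : G) }.

#[short(type="topologicalGroupType")]
HB.structure Definition TopologicalGroup :=
  {G of PointedTopological G & Group G & isTopologicalGroup G}.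

Notation borel T := (g_sigma_algebraType (@open T)).

Section Integration.
Context {R : realType}.

Definition rsum (I : choiceType) (D : set I) (a : I -> R) : R :=
  fine (\esum_(i in D) (a^\+ i)%:E) - fine (\esum_(i in D) (a^\- i)%:E).

(* The sum of an absolutely summable family; the value is meaningless for
   other families. *)
Definition csum (I : choiceType) (D : set I) (a : I -> R[i]) : R[i] :=
  rsum D (fun i => complex.Re (a i)) +i* rsum D (fun i => complex.Im (a i)).

Context {d : measure_display} {T : measurableType d}.
Variable mu : {measure set T -> \bar R}.

Definition cintegral (f : T -> R[i]) : R[i] :=
  (\int[mu]_x complex.Re (f x)) +i* (\int[mu]_x complex.Im (f x)).

Definition int_norm (D : set T) (f : T -> R[i]) : \bar R :=
  (\int[mu]_(x in D) (ComplexField.Normc.normc (f x))%:E)%E.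

Definition L1 (f : T -> R[i]) : Prop :=
  [/\ measurable_fun setT (fun x => complex.Re (f x)),
      measurable_fun setT (fun x => complex.Im (f x)) &
      (int_norm setT f < +oo)%E].

(* [f] represents an element of L^1 other than the class of 0. *)
Definition L1_neq0 (f : T -> R[i]) : Prop :=
  L1 f /\ ~ {ae mu, forall x, f x = 0}.

End Integration.

Definition radon (R : realType) (T : ptopologicalType)
    (mu : {measure set (borel T) -> \bar R}) : Prop :=
  [/\ forall K : set T, compact K -> (mu K < +oo)%E,
      forall A : set (borel T), measurable A ->
        mu A = ereal_inf [set mu U | U in [set U : set T | open U /\ A `<=` U]]
    & forall U : set T, open U ->
        mu U =
        ereal_sup [set mu K | K in [set K : set T | compact K /\ K `<=` U]]].

(* R[i]^o carries the topology given by the modulus. *)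
Definition Cc (R : realType) (T : topologicalType) (f : T -> R[i]) : Prop :=
  continuous (f : T -> R[i]^o) /\ compact (closure [set x | f x != 0]).

Section Haar.
Context {R : realType} {G : topologicalGroupType}.
Implicit Type mu : {measure set (borel G) -> \bar R}.

Definition left_invariant mu : Prop :=
  forall (g : G) (A : set (borel G)), measurable A ->
    mu [set (g * x)%g | x in (A : set G)] = mu A.

Definition right_invariant mu : Prop :=
  forall (g : G) (A : set (borel G)), measurable A ->
    mu [set (x * g)%g | x in (A : set G)] = mu A.

Definition haar mu : Prop :=
  [/\ radon mu, left_invariant mu & mu setT != 0%E].

End Haar.

Definition unimodular (R : realType) (G : topologicalGroupType) : Prop :=
  forall mu : {measure set (borel G) -> \bar R}, haar mu -> right_invariant mu.

Definition discrete_subgroup (G : topologicalGroupType) (Gamma : groupClosed G)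
    : Prop :=
  isolated [set` Gamma] = [set` Gamma].

Section LeftQuotient.
Context {G : topologicalGroupType}.
Variable Gamma : groupClosed G.

Definition coset_rel (x y : G) : bool := (x / y)%g \in Gamma.

Lemma coset_rel_equiv : equiv_class_of coset_rel.
Proof.
split=> [x|x y|y x z]; rewrite /coset_rel.
- by rewrite divgg gpred1.
- by rewrite gpredFC.
- by move=> xy yz; rewrite -(divgKA y) gpredM.
Qed.

Canonical coset_equiv_rel := EquivRelPack coset_rel_equiv.

(* The space of the cosets [Gamma x], with the quotient topology. *)
Definition left_quotient : ptopologicalType :=
  quotient_topology {eq_quot coset_rel}%qT.

Context {R : realType}.

Definition poincare (phi : G -> R[i]) (g : G) : R[i] :=
  csum [set` Gamma] (fun gamma => phi (gamma * g)%g).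

Lemma poincare_invariant (phi : G -> R[i]) (gamma g : G) :
  gamma \in Gamma -> poincare phi (gamma * g)%g = poincare phi g.
Proof.
move=> Gg; have bij : set_bij [set` Gamma] [set` Gamma] (fun x => x * gamma)%g.
  split=> [x /= xG|x y _ _ /mulIg //|x /= xG]; first exact: gpredM.
  by exists (x / gamma)%g; [exact: gpredF|rewrite mulgVK].
have rsumE (a : G -> R) :
    rsum [set` Gamma] (fun x => a (x * gamma)%g) = rsum [set` Gamma] a.
  rewrite /rsum (reindex_esum _ _ _ (fun x => (a^\+ x)%:E) bij).
  by rewrite (reindex_esum _ _ _ (fun x => (a^\- x)%:E) bij).
rewrite /poincare.
have -> : (fun x => phi (x * (gamma * g))%g) = fun x => phi (x * gamma * g)%g.
  by apply/funext => x; rewrite mulgA.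
rewrite /csum; congr (_ +i* _).
  exact: (rsumE (fun x => complex.Re (phi (x * g)%g))).
exact: (rsumE (fun x => complex.Im (phi (x * g)%g))).
Qed.

Definition poincare_quotient (phi : G -> R[i]) (x : left_quotient) : R[i] :=
  poincare phi (repr x).

Lemma poincare_quotientE (phi : G -> R[i]) (g : G) :
  poincare_quotient phi (\pi_left_quotient g)%qT = poincare phi g.
Proof.
rewrite /poincare_quotient; set x := repr _.
have xg : (x / g)%g \in Gamma.
  have : (x == g %[mod {eq_quot coset_rel}])%qT by apply/eqP; exact: reprK.
  by rewrite eqmodE.
by rewrite -[x](mulgVK g) poincare_invariant.
Qed.

(* For discrete [Gamma] in a unimodular [G] with Haar measure [muG], this
   determines the Radon measure [muQ]. *)
Definition quotient_measure (muG : {measure set (borel G) -> \bar R})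
    (muQ : {measure set (borel left_quotient) -> \bar R}) : Prop :=
  radon muQ /\
  forall f : G -> R[i], Cc f ->
    cintegral muQ (poincare_quotient f) = cintegral muG f.

End LeftQuotient.

(* Main.v *)
(** Choosing a Borel section [s] of [G -> Gamma\G] and summing the images of the
    quotient measure under [x |-> gamma * s x] gives a Borel measure on [G].  It
    has the same integrals of compactly supported continuous functions as the
    Haar measure, hence equals it, so that the unfolding formula
    [\int_(Gamma\G) P f = \int_G f] holds for every Borel [f >= 0].
    By (C2) at most one term of [P (phi 1_C)] is nonzero at each point, so
    [|P (phi 1_C)| = P (|phi| 1_C)].  If [P phi = 0] almost everywhere, then
    [P (|phi| 1_C) = |P (phi 1_(~C))| <= P (|phi| 1_(~C))] almost everywhere,
    and unfolding both sides contradicts (C1). *)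
Require Import Defs.
From HB Require Import structures.
From mathcomp Require Import all_boot all_order all_algebra complex finmap.
From mathcomp Require Import all_classical all_reals all_analysis.
From mathcomp Require Import measurable_realfun ring lra.
Import Order.TTheory GRing.Theory Num.Theory.
Import numFieldNormedType.Exports.
Local Open Scope classical_set_scope.
Local Open Scope ring_scope.
Local Open Scope complex_scope.

Local Notation normc := (@ComplexField.Normc.normc _).

(** * Countable bases and bump functions on locally compact Hausdorff spaces *)

(** Any neighbourhood can first be shrunk into a set satisfying [P]; a basic set inside it inherits
    [P], so the basic sets satisfying [P] still form a basis. *)
Lemma countable_basis_hereditary (T : ptopologicalType) (P : set (set T)) :
  @second_countable T ->
  (forall A B, A `<=` B -> P B -> P A) ->
  (forall x : T, exists2 V, nbhs x V & P V) ->
  exists B : nat -> set T,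
    [/\ forall n, open (B n), forall n, P (B n) &
        forall (x : T) U, nbhs x U -> exists n, B n x /\ B n `<=` U].
Proof.
move=> [C cC [Cop Cb]] Psub Ploc.
pose D := C `&` P.
have Db (x : T) U : nbhs x U -> exists2 V, D V & V x /\ V `<=` U.
  move=> xU; have [V xV PV] := Ploc x.
  have [W [CW Wx] WUV] := Cb x _ (filterI xU xV).
  exists W; last by split=> // y /WUV[].
  by split => //; apply: Psub PV => y /WUV[].
have : countable D by apply: sub_countable cC; apply: subset_card_le => x [].
(* [D] is nonempty, since [point] has a basic neighbourhood; hence all of [nat] enumerates it,
   possibly with repetitions. *)
move=> /pfcard_geP[D0|[f]].
  have [V] := Db point setT filterT.
  by rewrite D0.
have Df n : D (f n) by exact: funS.
exists f; split=> [n|n|x U xU].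
- by have [/Cop] := Df n.
- by have [] := Df n.
- have [V DV [Vx VU]] := Db x U xU.
  by have [n _ fn] := @surj _ _ _ _ f V DV; exists n; rewrite fn.
Qed.

Lemma locally_compact_nbhs (T : topologicalType) (x : T) :
  locally_compact [set: T] ->
  exists2 V, nbhs x V & compact V /\ closed V.
Proof.
move=> lcT; have [V xV cV] := lcT x I; exists V => //.
have : nbhs x (fun t => [set: T] t -> V t) := xV.
by apply: filterS => y; exact.
Qed.

(** Urysohn's lemma is applied in the one-point compactification, which is compact Hausdorff and
    hence normal. Replacing [U] by a smaller open set [W] contained in a compact [L] makes the
    support compact. *)
Lemma compact_bump (R : realType) (T : ptopologicalType) (K U : set T) :
  locally_compact [set: T] -> hausdorff_space T ->
  compact K -> open U -> K `<=` U ->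
  exists f : T -> R,
    [/\ continuous f, forall x, 0 <= f x <= 1, forall x, K x -> f x = 1,
        [set x | f x != 0] `<=` U & compact (closure [set x | f x != 0])].
Proof.
move=> lcT hT cK oU KU.
have /choice[V VP] (x : T) : exists V, nbhs x V /\ (compact V /\ closed V).
  by have [V xV cV] := locally_compact_nbhs T x lcT; exists V.
have [D _ KD] : finite_subset_cover setT (fun x => (V x)°) K.
  move: cK; rewrite compact_cover; apply=> x _; first exact: open_interior.
  by exists x => //; exact: (VP x).1.
pose L := \bigcup_(i in [set` D]) V i.
have cL : compact L.
  rewrite /L bigcup_fset.
  by apply: bigsetU_compact => x _; exact: (VP x).2.1.
have clL : closed L := compact_closed hT cL.
pose W := (cover [set` D] (fun x => (V x)°)) `&` U.
have oW : open W.
  by apply: openI => //; apply: bigcup_open => i _; exact: open_interior.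
have WL : W `<=` L.
  by move=> x [[i Di /interior_subset Vix] _]; exists i.
pose opc := one_point_compactification T.
have hopc : hausdorff_space opc by exact: one_point_compactification_hausdorff.
have /normal_separatorP : @normal_space opc.
  by apply: compact_normal => //; exact: one_point_compactification_compact.
move=> /(_ R (~` (Some @` W)) (Some @` K)) [].
- exact/open_closedC/one_point_compactification_open_some.
- apply: compact_closed => //; apply: continuous_compact => //.
  apply: continuous_subspaceT.
  exact: one_point_compactification_some_continuous.
- apply/seteqP; split=> // x [/[swap]] -[y Ky <-]; apply.
  by exists y => //; split; [exact: KD|exact: KU].
move=> uT [E sep].
have /(uniform_separatorP (R := R)) [f [cf f01 f0 f1]] :
    @uniform_separator opc (~` (Some @` W)) (Some @` K).
  by exists uT, E.
have fW x : f (Some x) != 0 -> W x.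
  apply: contra_neqP => nWx; apply: f0; exists (Some x) => //.
  by move=> -[y Wy [yx]]; apply: nWx; rewrite -yx.
exists (f \o Some); split.
- move=> x; apply: continuous_comp; last exact: cf.
  exact: one_point_compactification_some_continuous.
- by move=> x; have /= := f01 (f (Some x)); rewrite in_itv /=; apply;
    exists (Some x).
- by move=> x Kx; apply: f1; exists (Some x) => //; exists x.
- by move=> x /= /fW[].
- apply: (subclosed_compact _ cL); first exact: closed_closure.
  rewrite (closure_id L).1//; apply: closureS => x /fW; exact: WL.
Qed.

(** * Borel measures and their integrals of compactly supported continuous functions *)

Lemma open_borel (T : ptopologicalType) (U : set T) :
  open U -> measurable (U : set (borel T)).
Proof. exact: sub_sigma_algebra. Qed.

Lemma closed_borel (T : ptopologicalType) (F : set T) :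
  closed F -> measurable (F : set (borel T)).
Proof.
move=> cF; rewrite -[F]setCK; apply: measurableC.
by apply: open_borel; exact: closed_openC.
Qed.

Lemma continuous_borel_measurable (R : realType) (T : ptopologicalType)
  (h : T -> R) : continuous h -> measurable_fun [set: borel T] h.
Proof.
move=> /continuousP ch; apply: (measurability _ (RGenOpens.measurableE R)).
move=> _ [_ [a [b ->] <-]]; rewrite setTI; apply: open_borel; apply: ch.
exact: interval_open.
Qed.

Section borel_measure_uniqueness.
Context (R : realType) (T : ptopologicalType).
Hypotheses (lcT : locally_compact [set: T]) (hT : hausdorff_space T).
Hypothesis scT : @second_countable T.
Implicit Types m : {measure set (borel T) -> \bar R}.

Let bump (h : T -> R) := [/\ continuous h, forall x, 0 <= h x <= 1 &
  compact (closure [set x | h x != 0])].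

(** Relative compactness passes to subsets, which gives basic sets with compact closure; regularity
    inside a compact neighbourhood then puts the closure into [U]. *)
Lemma relatively_compact_basis : exists B : nat -> set T,
  [/\ forall n, open (B n), forall n, compact (closure (B n)) &
      forall (x : T) U, nbhs x U -> exists n, B n x /\ closure (B n) `<=` U].
Proof.
have nbhs_cpt (x : T) : exists2 V, nbhs x V & compact V.
  by have [V xV [cV _]] := locally_compact_nbhs T x lcT; exists V.
have [B [oB cB bB]] : exists B : nat -> set T, [/\ forall n, open (B n),
    forall n, compact (closure (B n)) &
    forall (x : T) U, nbhs x U -> exists n, B n x /\ B n `<=` U].
  apply: (@countable_basis_hereditary T (fun A => compact (closure A))) => //.
  - move=> A C AC cC; apply: (subclosed_compact _ cC).
      exact: closed_closure.
    exact: closureS.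
  - move=> x; have [V xV cV] := nbhs_cpt x; exists V => //.
    by rewrite -(closure_id V).1//; exact: compact_closed.
exists B; split=> // x U xU; have [V xV cV] := nbhs_cpt x.
have [W xW WU] := compact_regular hT cV xV xU.
have [n [Bnx BnW]] := bB x W xW.
by exists n; split=> //; apply: subset_trans WU; exact: closureS.
Qed.

(** [U] is an increasing union of compact sets [K n]. A bump [f] lying between the indicators of
    [K n] and [U] gives [m1 (K n) <= \int[m1] f <= \int[m2] f <= m2 U], and continuity from below
    concludes. *)
Lemma le_open_measure m1 m2 (U : set T) :
  (forall h, bump h -> (\int[m1]_x (h x)%:E <= \int[m2]_x (h x)%:E)%E) ->
  open U -> (m1 U <= m2 U)%E.
Proof.
move=> m12 oU; have [B [oB cB bB]] := relatively_compact_basis.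
(* Basic sets whose closure leaves [U] are replaced by the empty set, so that all finite unions stay
   inside [U]. *)
pose F i := if `[< closure (B i) `<=` U >] then closure (B i) else set0.
have FU i : F i `<=` U.
  by rewrite /F; case: asboolP => // _; exact: sub0set.
have cF i : compact (F i).
  by rewrite /F; case: asboolP => // _; exact: compact0.
pose K n := \big[setU/set0]_(i < n) F i.
have cK n : compact (K n) by exact: bigsetU_compact.
have KU n : K n `<=` U by rewrite /K -bigcup_mkord; apply: bigcup_sub.
have UE : U = \bigcup_n K n.
  apply/seteqP; split; last by apply: bigcup_sub.
  move=> x Ux; have [n [Bnx BnU]] := bB x U (open_nbhs_nbhs (conj oU Ux)).
  exists n.+1 => //; rewrite /K -bigcup_mkord; exists n => //=.
  by rewrite /F asboolT//; exact: subset_closure.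
have mK n : measurable (K n : set (borel T)).
  by apply: closed_borel; exact: compact_closed.
have mU : measurable (U : set (borel T)) by exact: open_borel.
have K_U : (m1 \o K @ \oo --> m1 U).
  rewrite [in X in _ --> X]UE; apply: nondecreasing_cvg_mu => //.
    by rewrite -UE.
  by move=> i j ij; apply/subsetPset; exact: subset_bigsetU.
rewrite -(cvg_lim _ K_U)//; apply: lime_le.
  by apply/cvg_ex; exists (m1 U).
apply: nearW => n /=.
have [f [cf f01 f1 fU cptf]] :=
  @compact_bump R T (K n) U lcT hT (cK n) oU (KU n).
have mf : measurable_fun [set: borel T] (EFin \o f).
  by apply/measurable_EFinP; exact: continuous_borel_measurable.
have f0 x : 0 <= f x by case/andP: (f01 x).
apply: (@le_trans _ _ (\int[m1]_x (f x)%:E)%E).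
  have -> : m1 (K n) = (\int[m1]_x (\1_(K n) x)%:E)%E.
    by rewrite integral_indic// setIT.
  apply: ge0_le_integral => //.
  - by apply/measurable_EFinP; exact: measurable_indic.
  - move=> x _; rewrite lee_fin indicE.
    by have [/set_mem/f1 ->//|_] := boolP (x \in _); exact: f0.
apply: (le_trans (m12 f _)) => //.
have -> : m2 (U) = (\int[m2]_x (\1_(U) x)%:E)%E.
  by rewrite integral_indic// setIT.
apply: ge0_le_integral => //.
- by move=> x _; rewrite lee_fin.
- by apply/measurable_EFinP; exact: measurable_indic.
- move=> x _; rewrite lee_fin indicE.
  have [xU|xU] := boolP (x \in _); first by case/andP: (f01 x).
  suff -> : f x = 0 by [].
  by apply: contraNeq xU => fx; rewrite inE; exact: fU.
Qed.

(** Open sets are stable under intersection and generate the Borel sets, and countably many of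
    finite [m1]-measure cover the space; hence agreement on open sets suffices, and it follows from
    the previous inequality used in both directions. *)
Lemma borel_measure_unique m1 m2 :
  (forall K, compact K -> (m1 K < +oo)%E) ->
  (forall h, bump h -> (\int[m1]_x (h x)%:E = \int[m2]_x (h x)%:E)%E) ->
  forall A : set (borel T), measurable A -> m1 A = m2 A.
Proof.
move=> m1fin m12; have [B [oB cB bB]] := relatively_compact_basis.
apply: (@measure_unique _ R (borel T) (@open T) B) => //.
- by move=> A C; exact: openI.
- apply/seteqP; split=> // x _.
  by have [n [Bnx _]] := bB x setT filterT; exists n.
- move=> U oU; apply/eqP; rewrite eq_le.
  by apply/andP; split; apply: le_open_measure => // h /m12 ->.
- move=> n; apply: (le_lt_trans _ (m1fin _ (cB n))); apply: le_measure.
  + by rewrite inE; exact: open_borel.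
  + by rewrite inE; apply: closed_borel; exact: closed_closure.
  + exact: subset_closure.
Qed.

End borel_measure_uniqueness.

(** * The projection onto the coset space *)

Section coset_projection.
Context {G : topologicalGroupType} (Gamma : groupClosed G).
Local Notation Q := (left_quotient Gamma).
Local Notation pi := (\pi_Q : G -> Q)%qT.

Lemma pi_eqP (x y : G) : pi x = pi y <-> (x / y)%g \in Gamma.
Proof.
have E : (x == y %[mod {eq_quot (coset_rel Gamma)}])%qT = ((x / y)%g \in Gamma).
  by rewrite eqmodE.
by rewrite -E; split=> [xy|/eqP //]; exact/eqP.
Qed.

Lemma pi_mulg (gamma x : G) : gamma \in Gamma -> pi (gamma * x)%g = pi x.
Proof. by move=> Gg; apply/pi_eqP; rewrite mulgK. Qed.

Lemma mulg_left_continuous (a : G) : continuous (fun x : G => (a * x)%g).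
Proof.
move=> x.
apply: (@continuous_comp _ _ _ (fun y : G => (a, y)) (fun z => (z.1 * z.2)%g)).
  by apply: cvg_pair => //=; exact: cvg_cst.
exact: mulg_continuous.
Qed.

(** The saturation of [U] is a union of preimages of [U] under left translations, and a set of
    cosets is open exactly when its preimage is. *)
Lemma pi_open (U : set G) : open U -> open (pi @` U).
Proof.
move=> oU; change (open (pi @^-1` (pi @` U))).
have -> : pi @^-1` (pi @` U) =
    \bigcup_(gamma in [set` Gamma]) (fun x => gamma * x)%g @^-1` U.
  apply/seteqP; split=> [x [u Uu /pi_eqP ux]|x [gamma Gg Ux]].
    by exists (u / x)%g => //=; rewrite divgK.
  by exists (gamma * x)%g => //; exact: pi_mulg.
apply: bigcup_open => gamma _.
by move/continuousP : (mulg_left_continuous gamma); apply.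
Qed.

(** Some neighbourhood [W] of 1 meets [Gamma] only in 1. By continuity of division, points close
    enough to [x] have quotient in [W]; if they share a coset, this quotient is 1. *)
Lemma discrete_injective_nbhs : discrete_subgroup Gamma ->
  forall x : G, exists2 V : set G, nbhs x V & {in V &, injective pi}.
Proof.
move=> dG x; have : [set` Gamma] 1%g by exact: gpred1.
rewrite -dG => -[_ [W W1 WG]].
have cinv : {for (x, x), continuous (fun z : G * G => z.2^-1%g)}.
  apply: (@continuous_comp _ _ _ (snd : G * G -> G) (fun y : G => y^-1%g)).
    exact: cvg_snd.
  exact: invg_continuous.
have cdiv : {for (x, x), continuous (fun z : G * G => (z.1 / z.2)%g)}.
  apply: (@continuous_comp _ _ _ (fun z : G * G => (z.1, z.2^-1%g))
    (fun z => (z.1 * z.2)%g)); last exact: mulg_continuous.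
  by apply: cvg_pair; [exact: cvg_fst|exact: cinv].
have : nbhs (x, x) ((fun z : G * G => (z.1 / z.2)%g) @^-1` W).
  by apply: cdiv; rewrite /= divgg.
move=> [[A B] /= [xA xB] ABW]; exists (A `&` B); first exact: filterI.
move=> c d; rewrite !inE => -[Ac _] [_ Bd] /pi_eqP cdG.
have : (W `&` [set` Gamma]) (c / d)%g by split=> //; exact: (ABW (c, d)).
by rewrite WG => /= /divg1_eq.
Qed.

End coset_projection.

(** * Countable sums of functions and of measures *)

(** Indexing by a subset [P] of [nat] keeps the enumeration injective for finite [D] too, as needed
    to rewrite sums over [D] as series. *)
Lemma countable_enumeration (I : pointedType) (D : set I) : countable D ->
  exists (P : set nat) (e : nat -> I), set_inj P e /\ D = e @` P.
Proof.
move=> /countable_injP[f finj].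
have /choice[e eP] (n : nat) : exists i, (f @` D) n -> D i /\ f i = n.
  have [[i Di fi]|nD] := pselect ((f @` D) n); first by exists i.
  by exists point.
exists (f @` D), e; split.
  by move=> m n /set_mem/eP[_ {2}<-] /set_mem/eP[_ {2}<-] ->.
apply/seteqP; split=> [i Di|_ [n /eP[Di _] <-] //].
have /eP[Dj fj] : (f @` D) (f i) by exists i.
by exists (f i); [exists i|apply: finj; rewrite ?inE].
Qed.

Section countable_sum.
Local Open Scope ereal_scope.
Context d (X : measurableType d) (R : realType) (I : pointedType) (D : set I).
Hypothesis cD : countable D.

Lemma measurable_esum (h : I -> X -> \bar R) :
  (forall i, D i -> measurable_fun setT (h i)) -> (forall i x, 0 <= h i x) ->
  measurable_fun setT (fun x => \esum_(i in D) h i x).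
Proof.
move=> mh h0; have [P [e [einj DE]]] := countable_enumeration _ _ cD.
rewrite DE; under eq_fun do rewrite esum_set_image//.
apply: ge0_emeasurable_sum => // n nP; apply: mh; rewrite DE.
by exists n => //; exact/set_mem.
Qed.

(** The measure [nu] is the sum over [D] of the pushforwards of [mu] under [g i], written as a
    series in which indices outside [P] carry the zero measure. *)
Lemma sum_pushforward d' (Y : measurableType d')
    (mu : {measure set X -> \bar R}) (g : I -> X -> Y) :
  (forall i, measurable_fun setT (g i)) ->
  exists nu : {measure set Y -> \bar R}, forall f : Y -> \bar R,
    measurable_fun setT f -> (forall y, 0 <= f y) ->
    \int[nu]_y f y = \int[mu]_x \esum_(i in D) f (g i x).
Proof.
move=> mg; have [P [e [einj DE]]] := countable_enumeration _ _ cD.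
pose m' n : {measure set Y -> \bar R} :=
  if n \in P then (pushforward mu (g (e n)) : {measure set Y -> \bar R})
  else (mzero : {measure set Y -> \bar R}).
pose m := m' (fun n => mg (e n)).
exists (mseries m 0) => f mf f0.
rewrite ge0_integral_measure_series//.
have sumE x : \esum_(i in D) f (g i x) =
    \sum_(n <oo) if n \in P then f (g (e n) x) else 0.
  by rewrite DE esum_set_image// eseries_mkcond.
under [RHS]eq_integral do rewrite sumE.
rewrite integral_nneseries//=; last 2 first.
- by move=> n; case: (boolP (n \in P)) => // _; exact: measurableT_comp.
- by move=> n x _; case: ifPn.
apply: eq_eseriesr => n _; rewrite /m /m'; case: (boolP (n \in P)) => _.
  by rewrite ge0_integral_pushforward//.
by rewrite integral_measure_zero integral0.
Qed.

End countable_sum.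

Lemma esum_single (R : realType) (I : choiceType) (D : set I) (j : I)
  (a : I -> \bar R) : (forall i, 0 <= a i)%E -> D j ->
  (forall i, D i -> i != j -> a i = 0%E) -> (\esum_(i in D) a i = a j)%E.
Proof.
move=> a0 Dj aj; rewrite (esumID [set j])//.
rewrite [X in (X + _)%E](_ : _ = a j); last first.
  rewrite (_ : D `&` [set j] = [set j]) ?esum_set1//.
  by apply/seteqP; split=> [i []|i ->].
by rewrite esum1 ?adde0// => i [Di /= /eqP]; exact: aj.
Qed.

(** * Borel images and a Borel section of the projection *)

Section slices.
Context {G : topologicalGroupType} (Gamma : groupClosed G).
Hypothesis scG : @second_countable G.
Hypothesis dG : discrete_subgroup Gamma.
Local Notation Q := (left_quotient Gamma).
Local Notation pi := (\pi_Q : G -> Q)%qT.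

Lemma injective_basis : exists B : nat -> set G,
  [/\ forall n, open (B n), forall n, {in B n &, injective pi} &
      forall x : G, exists n, B n x].
Proof.
have [] := @countable_basis_hereditary G (fun A => {in A &, injective pi}) scG.
- move=> A B AB injB x y /set_mem Ax /set_mem Ay.
  by apply: injB; apply/mem_set; exact: AB.
- exact: discrete_injective_nbhs.
- move=> B [oB iB bB]; exists B; split=> // x.
  by have [n [Bx _]] := bB x setT filterT; exists n.
Qed.

(** All of [Gamma] lies in a single fibre of [pi], so each set of the countable cover contains at
    most one of its elements. *)
Lemma discrete_countable : countable [set` Gamma].
Proof.
have [B [oB iB cB]] := injective_basis.
have [f fB] := choice cB.
apply/countable_injP; exists f => x y; rewrite !inE /= => xG yG fxy.
apply: (iB (f x)); rewrite ?inE//; first by rewrite fxy.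
by apply/pi_eqP; exact: gpredF.
Qed.

Lemma pi_closed_borel (F : set G) : closed F ->
  measurable (pi @` F : set (borel Q)).
Proof.
move=> cF; have [B [oB iB cB]] := injective_basis.
have -> : pi @` F = \bigcup_n (pi @` B n `\` pi @` (B n `&` ~` F)).
  apply/seteqP; split=> [_ [x Fx <-]|_ [n _ [[x Bx <-] nFx]]].
    have [n Bx] := cB x; exists n => //; split; first by exists x.
    move=> [y [By nFy] /(iB n) yx]; apply: nFy.
    by rewrite yx ?inE.
  by exists x => //; apply: contrapT => nF; apply: nFx; exists x.
apply: bigcup_measurable => n _; apply: measurableD; apply: open_borel.
  exact: pi_open.
by apply: pi_open; apply: openI => //; exact: closed_openC.
Qed.

(* [s x] is the unique lift of [x] to the first set of [injective_basis] that
   meets the fibre of [x]. *)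
Lemma borel_section : exists s : borel Q -> borel G,
  measurable_fun setT s /\ forall x, pi (s x) = x.
Proof.
have [B [oB iB cB]] := injective_basis.
have /choice[s sP] (x : Q) : exists y : G, exists n,
    [/\ B n y, pi y = x & forall m, (m < n)%N -> ~ (pi @` B m) x].
  have exn : exists n, `[< (pi @` B n) x >].
    have [n Bn] := cB (repr x); exists n; apply/asboolP.
    by exists (repr x) => //; exact: reprK.
  case: (ex_minnP exn) => n /asboolP[y By yx] nmin.
  exists y, n; split=> // m mn.
  by move=> /asboolP/nmin; rewrite leqNgt mn.
exists s; split; last by move=> x; have [n []] := sP x.
apply: (@measurability _ _ (borel Q) (borel G) setT s (@open G) erefl).
move=> _ [A oA <-].
rewrite setTI.
(* Points are sorted by the first [n] whose [B n] meets their fibre; there [s x] is the only lift in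
   [B n], so it lies in [A] exactly when [x] is in the image of [B n] meet [A]. *)
have -> : s @^-1` A =
    \bigcup_n (pi @` (B n `&` A) `\` \bigcup_(m in `I_n) pi @` B m).
  apply/seteqP; split=> [x /= As|x [n _ [[y [By Ay] yx]]]].
    have [n [Bn sx nmin]] := sP x; exists n => //; split; first by exists (s x).
    by move=> [m /= /nmin].
  move=> nB /=; have [k [Bk sx kmin]] := sP x.
  have kn : k = n.
    apply/eqP; rewrite eqn_leq; apply/andP; split; rewrite leqNgt; apply/negP.
      by move=> /kmin; apply; exists y.
    by move=> kn; apply: nB; exists k => //; exists (s x).
  have -> : s x = y by apply: (iB n); rewrite ?inE -?kn// ?kn// sx.
  by [].
apply: bigcup_measurable => n _; apply: measurableD.
  by apply: open_borel; apply: pi_open; exact: openI.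
by apply: bigcup_measurable => m _; apply: open_borel; exact: pi_open.
Qed.

End slices.

(** * The unfolding formula *)

Lemma real_complex_continuous (R : realType) :
  continuous (fun x : R => x%:C : R[i]^o).
Proof.
move=> x; apply/cvgrPdist_lt => /= e; rewrite ltcE /= => /andP[/eqP e0 e1].
have xx : (fun y : R => y) y @[y --> x] --> x by exact: cvg_id.
move/cvgrPdist_lt : xx => /(_ _ e1).
apply: filterS => y xy.
by rewrite -rmorphB /= normc_def /= expr0n addr0 sqrtr_sqr ltcE /= e0 eqxx.
Qed.

Section unfolding.
Context {R : realType} {G : topologicalGroupType} (Gamma : groupClosed G).
Hypothesis lcG : locally_compact [set: G].
Hypothesis hG : hausdorff_space G.
Hypothesis scG : @second_countable G.
Hypothesis dG : discrete_subgroup Gamma.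
Local Notation Q := (left_quotient Gamma).
Local Notation pi := (\pi_Q : G -> Q)%qT.
Variable muG : {measure set (borel G) -> \bar R}.
Variable muQ : {measure set (borel Q) -> \bar R}.
Hypothesis muG_fin : forall K, compact K -> (muG K < +oo)%E.
Hypothesis muQG : quotient_measure muG muQ.

Variable s : borel Q -> borel G.
Hypothesis ms : measurable_fun setT s.
Hypothesis sK : forall x, pi (s x) = x.

Lemma mulg_section_measurable (gamma : G) :
  measurable_fun setT (fun x => (gamma * s x)%g : borel G).
Proof.
apply: (@measurable_comp _ _ _ _ _ _ setT
  (fun y : borel G => (gamma * y)%g : borel G) _ s) => //.
apply: (@measurability _ _ (borel G) (borel G) setT _ (@open G) erefl).
move=> _ [A oA <-]; rewrite setTI; apply: open_borel.
by move/continuousP : (mulg_left_continuous gamma); apply.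
Qed.

(** This is the Poincaré series of a nonnegative function, read at the representative [s x]; values
    in [\bar R] dispense with convergence questions. *)
Definition orbit_sum (f : borel G -> \bar R) (x : borel Q) : \bar R :=
  (\esum_(gamma in [set` Gamma]) f (gamma * s x)%g)%E.

Lemma orbit_sum_measurable (f : borel G -> \bar R) :
  measurable_fun setT f -> (forall y, 0 <= f y)%E ->
  measurable_fun setT (orbit_sum f).
Proof.
move=> mf f0; apply: measurable_esum => //.
  exact: (discrete_countable Gamma scG dG).
move=> gamma _; apply: (@measurable_comp _ _ _ _ _ _ setT f _
  (fun x => (gamma * s x)%g : borel G)) => //.
exact: mulg_section_measurable.
Qed.

(** The translates of [s x] all lie in one fibre, so at most one of them is in [U]. *)
Lemma orbit_sum_indic_le (U : set G) x : {in U &, injective pi} ->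
  (orbit_sum (fun y => (\1_U y)%:E) x <= (\1_(pi @` U) x)%:E)%E.
Proof.
move=> iU; rewrite /orbit_sum.
have [[g [gG Ug]]|nU] := pselect (exists g, g \in Gamma /\ U (g * s x)%g).
  rewrite (@esum_single _ _ _ g)//; last first.
    move=> i iG /eqP ig; rewrite indicE memNset// => Ui; apply: ig.
    apply: (@mulIg _ (s x)); apply: iU; rewrite ?inE//.
    by rewrite !pi_mulg.
  rewrite indicE mem_set// indicE mem_set//.
  by exists (g * s x)%g => //; rewrite pi_mulg.
rewrite esum1 ?lee_fin// => i iG; rewrite indicE memNset// => Ui.
by apply: nU; exists i.
Qed.

(** [K] is covered by finitely many open sets, each inside some [V] on which [pi] is injective and
    some compact [W]. The [nu]-measure of such a set is at most [muQ (pi @] W)[, finite because]pi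
    @[W] is compact. *)
Lemma integral_orbit_sum_compact_lty (nu : {measure set (borel G) -> \bar R}) :
  (forall f : borel G -> \bar R, measurable_fun setT f ->
    (forall y, 0 <= f y)%E ->
    \int[nu]_y f y = \int[muQ]_x orbit_sum f x)%E ->
  forall K : set G, compact K -> (nu K < +oo)%E.
Proof.
move=> nuE K cK.
have mK : measurable (K : set (borel G)).
  by apply: closed_borel; exact: compact_closed.
have /choice[U UP] (x : G) :
    exists U : set G, [/\ open U, U x & (nu U < +oo)%E].
  have [V xV iV] := discrete_injective_nbhs Gamma dG x.
  have [W xW [cW clW]] := locally_compact_nbhs G x lcG.
  exists (V `&` W)°; split; first exact: open_interior.
    by apply: filterI.
  have oU : open (V `&` W)° by exact: open_interior.
  have mU : measurable ((V `&` W)° : set (borel G)) by exact: open_borel.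
  have UVW : (V `&` W)° `<=` V `&` W by exact: interior_subset.
  (* No separation property of the quotient is at hand, so measurability comes from [W] being closed
     in [G] and not from compactness of the image. *)
  have mW : measurable (pi @` W : set (borel Q)) by exact: pi_closed_borel.
  have mind (A : set (borel G)) : measurable A ->
      measurable_fun setT (fun y : borel G => (\1_A y)%:E : \bar R).
    by move=> mA; apply/measurable_EFinP; exact: measurable_indic.
  have [[muQ_fin _ _] _] := muQG.
  rewrite -[X in nu X]setIT -integral_indic// nuE//; last exact: (mind _ mU).
  apply: le_lt_trans (muQ_fin (pi @` W) _); last first.
    apply: continuous_compact => //; apply: continuous_subspaceT.
    exact: pi_continuous.
  rewrite -[X in (_ <= muQ X)%E]setIT -integral_indic//.
  apply: ge0_le_integral => //.
  - by move=> y _; apply: esum_ge0 => i _; rewrite lee_fin.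
  - apply: orbit_sum_measurable; first exact: (mind _ mU).
    by move=> y; rewrite lee_fin.
  - by apply/measurable_EFinP; exact: measurable_indic.
  - move=> x0 _; apply: le_trans (orbit_sum_indic_le _ _ _) _.
      move=> y z /set_mem/UVW[Vy _] /set_mem/UVW[Vz _].
      by apply: iV; exact/mem_set.
    rewrite lee_fin !indicE ler_nat.
    have [/set_mem[y /UVW[_ Wy] yx]|//] := boolP (x0 \in pi @` _).
    by rewrite mem_set//; exists y.
have [D _ KD] : finite_subset_cover setT U K.
  move: cK; rewrite compact_cover; apply=> [x _|x _]; first by have [] := UP x.
  by exists x => //; have [] := UP x.
apply: (@le_lt_trans _ _ (\sum_(i \in [set` D]) nu (U i))%E).
  apply: content_sub_fsum => // i _; apply: open_borel.
  by have [] := UP i.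
rewrite fsbig_finite//=; apply: lte_sum_pinfty => i _.
by have [] := UP i.
Qed.

Lemma rsum_ge0 (I : choiceType) (D : set I) (a : I -> R) :
  (forall i, 0 <= a i) -> rsum D a = fine (\esum_(i in D) (a i)%:E).
Proof.
move=> a0; rewrite /rsum (eq_esum (b := fun i => (a i)%:E)); last first.
  by move=> i _; rewrite (@ge0_funrposE _ _ setT)// inE.
rewrite [X in _ - fine X]esum1 ?subr0// => i _.
by rewrite /funrneg max_r ?oppr_le0.
Qed.

Lemma poincare_quotient_sectionE (phi : G -> R[i]) (x : Q) :
  poincare_quotient phi x =
  csum [set` Gamma] (fun gamma => phi (gamma * s x)%g).
Proof. by rewrite -[in LHS](sK x) poincare_quotientE. Qed.

Lemma integral_orbit_sum (f : borel G -> \bar R) :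
  measurable_fun setT f -> (forall y, 0 <= f y)%E ->
  (\int[muQ]_x orbit_sum f x = \int[muG]_y f y)%E.
Proof.
have [nu nuE] := sum_pushforward _ _ _ _ _
  (discrete_countable Gamma scG dG) _ _ muQ
  (fun gamma x => (gamma * s x)%g : borel G) mulg_section_measurable.
have nu_fin := integral_orbit_sum_compact_lty nu nuE.
move=> mf f0; rewrite -[LHS]nuE//.
apply: eq_measure_integral => A mA _; apply/esym.
apply: borel_measure_unique => // {f A mf f0 mA} h [ch h01 cpth].
have h0 x : 0 <= h x by case/andP: (h01 x).
have mh : measurable_fun [set: borel G] (EFin \o h).
  by apply/measurable_EFinP; exact: continuous_borel_measurable.
have fin_int (mu : {measure set (borel G) -> \bar R}) :
    (forall K : set G, compact K -> (mu K < +oo)%E) ->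
    (\int[mu]_x (h x)%:E \is a fin_num)%E.
  move=> mu_fin; rewrite ge0_fin_numE; last first.
    by apply: integral_ge0 => x _; rewrite lee_fin.
  pose K := closure [set x | h x != 0].
  have mK : measurable (K : set (borel G)).
    by apply: closed_borel; exact: closed_closure.
  apply: le_lt_trans (mu_fin K cpth).
  rewrite -[X in (_ <= mu X)%E]setIT -integral_indic//.
  apply: ge0_le_integral => //.
  - by move=> x _; rewrite lee_fin.
  - by apply/measurable_EFinP; exact: measurable_indic.
  - move=> x _; rewrite lee_fin indicE.
    have [xK|xK] := boolP (x \in _); first by case/andP: (h01 x).
    suff -> : h x = 0 by [].
    apply: contraNeq xK => hx; rewrite inE; exact: subset_closure.
have nuh := fin_int _ nu_fin.
pose S := orbit_sum (EFin \o h).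
have mS : measurable_fun setT S.
  by apply: orbit_sum_measurable => // x; rewrite lee_fin.
have S0 x : (0 <= S x)%E by apply: esum_ge0 => i _; rewrite lee_fin.
have nuhE : (\int[nu]_x (h x)%:E = \int[muQ]_x S x)%E.
  by apply: nuE => // x; rewrite lee_fin.
have intS : muQ.-integrable setT S.
  apply/integrableP; split=> //; under eq_integral do rewrite gee0_abs//.
  by rewrite -nuhE ltey_eq nuh.
have Cch : Cc (fun x => (h x)%:C).
  split.
    move=> x; apply: (@continuous_comp _ _ _ h (fun r => r%:C : R[i]^o)).
      exact: ch.
    exact: real_complex_continuous.
  rewrite (_ : [set x | (h x)%:C != 0] = [set x | h x != 0])//.
  by apply/seteqP; split=> x /=; rewrite fmorph_eq0.
have [_ /(_ _ Cch)] := muQG; rewrite /cintegral /Rintegral => -[hE _].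
apply/esym.
(* The formula defining [muQ] compares integrals only through [fine]; finiteness of both sides lifts
   the equality to [\bar R]. *)
rewrite -(fineK (fin_int _ muG_fin)) -(fineK nuh) -hE nuhE; congr (fine _)%:E.
have PE (x : Q) :
    rsum [set` Gamma] (fun gamma => h (gamma * repr x)%g) = fine (S x).
  transitivity (complex.Re (poincare_quotient (fun y => (h y)%:C) x)) => //.
  by rewrite poincare_quotient_sectionE /= rsum_ge0.
under [in RHS]eq_integral do rewrite PE.
(* [fine (S x)] agrees with [S x] where the latter is finite, which integrability of [S] ensures
   almost everywhere. *)
apply: ae_eq_integral => //.
  apply/measurable_EFinP.
  by apply: (@measurable_comp _ _ _ _ _ _ setT (@fine R) _ S).
have := integrable_ae measurableT intS; apply: filterS => x Sx _.
by rewrite /= fineK// Sx.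
Qed.

End unfolding.

(** * Sums of real and complex families *)

Lemma esumZl (R : realType) (I : choiceType) (D : set I) (r : R)
  (a : I -> \bar R) : 0 <= r -> (forall i, 0 <= a i)%E ->
  (\esum_(i in D) (r%:E * a i) = r%:E * \esum_(i in D) a i)%E.
Proof.
move=> r0 a0; rewrite /esum -ereal_supZl//; last first.
  by apply/set0P; exists 0%E, set0; rewrite ?fsbig_set0//; exact: fsets_set0.
rewrite image_comp; congr (ereal_sup _); apply: eq_imagel => A _ /=.
by rewrite ge0_mule_fsumr.
Qed.

(** Absolute summability makes both sums finite, so that equality of their [fine] values is equality
    of the sums themselves. *)
Lemma rsum_eq0 (R : realType) (I : choiceType) (D : set I) (a : I -> R) :
  (\esum_(i in D) `|a i|%:E < +oo)%E -> rsum D a = 0 ->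
  exists2 S : R, (\esum_(i in D) (a^\+ i)%:E = S%:E)%E &
                 (\esum_(i in D) (a^\- i)%:E = S%:E)%E.
Proof.
move=> afin.
have finp (b : I -> R) : (forall i, 0 <= b i <= `|a i|) ->
    (\esum_(i in D) (b i)%:E \is a fin_num)%E.
  move=> ba; rewrite ge0_fin_numE.
    apply: le_lt_trans afin; apply: le_esum => i _.
    by rewrite lee_fin; case/andP: (ba i).
  by apply: esum_ge0 => i _; rewrite lee_fin; case/andP: (ba i).
have fp : (\esum_(i in D) (a^\+ i)%:E \is a fin_num)%E.
  by apply: finp => i; rewrite funrpos_ge0 /funrpos ge_max ler_norm normr_ge0.
have fn : (\esum_(i in D) (a^\- i)%:E \is a fin_num)%E.
  apply: finp => i; rewrite funrneg_ge0 /funrneg ge_max -normrN.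
  by rewrite ler_norm normr_ge0.
rewrite /rsum => /eqP; rewrite subr_eq0 => /eqP e.
exists (fine (\esum_(i in D) (a^\+ i)%:E)); first by rewrite fineK.
by rewrite e fineK.
Qed.

Lemma normc_ge0 (R : rcfType) (z : R[i]) : 0 <= normc z.
Proof. by case: z => x y; exact: sqrtr_ge0. Qed.

Lemma sqr_normcE (R : rcfType) (z : R[i]) :
  normc z ^+ 2 = complex.Re z ^+ 2 + complex.Im z ^+ 2.
Proof. by case: z => x y /=; rewrite sqr_sqrtr// addr_ge0// sqr_ge0. Qed.

Lemma normRe_le_normc (R : rcfType) (z : R[i]) : `|complex.Re z| <= normc z.
Proof.
case: z => x y /=; rewrite -[leLHS]sqrtr_sqr.
by rewrite ler_wsqrtr// lerDl sqr_ge0.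
Qed.

Lemma normIm_le_normc (R : rcfType) (z : R[i]) : `|complex.Im z| <= normc z.
Proof.
case: z => x y /=; rewrite -[leLHS]sqrtr_sqr.
by rewrite ler_wsqrtr// lerDr sqr_ge0.
Qed.

Lemma normc_le_ReIm (R : rcfType) (z : R[i]) :
  normc z <= `|complex.Re z| + `|complex.Im z|.
Proof.
have := sqr_normcE _ z; rewrite -(real_normK (num_real (complex.Re z))).
rewrite -(real_normK (num_real (complex.Im z))) => e.
rewrite -(ler_pXn2r (ltn0Sn 1)) ?nnegrE ?normc_ge0 ?addr_ge0// e sqrrD.
by rewrite lerD2r lerDl mulrn_wge0// mulr_ge0.
Qed.

Lemma normc_Cauchy_Schwarz (R : rcfType) (z w : R[i]) :
  - (complex.Re z * complex.Re w + complex.Im z * complex.Im w) <=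
  normc z * normc w.
Proof.
apply: le_trans (ler_norm _) _; rewrite normrN.
rewrite -(ler_pXn2r (ltn0Sn 1)) ?nnegrE ?mulr_ge0 ?normc_ge0//.
rewrite exprMn !sqr_normcE real_normK ?num_real// -subr_ge0.
(* This is Lagrange's identity. *)
rewrite [leRHS](_ : _ = (complex.Re z * complex.Im w -
  complex.Im z * complex.Re w) ^+ 2) ?sqr_ge0//; ring.
Qed.

(** The four families are meant to be the positive and negative parts of the real and imaginary
    parts; nonnegative coefficients keep every sum free of infinite differences. *)
Lemma esum_lincomb4 (R : realType) (I : choiceType) (D : set I)
  (a1 a2 a3 a4 : I -> R) (c1 c2 c3 c4 S1 S2 S3 S4 : R) :
  [/\ forall i, 0 <= a1 i, forall i, 0 <= a2 i, forall i, 0 <= a3 i &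
      forall i, 0 <= a4 i] ->
  [/\ 0 <= c1, 0 <= c2, 0 <= c3 & 0 <= c4] ->
  [/\ \esum_(i in D) (a1 i)%:E = S1%:E, \esum_(i in D) (a2 i)%:E = S2%:E,
      \esum_(i in D) (a3 i)%:E = S3%:E & \esum_(i in D) (a4 i)%:E = S4%:E]%E ->
  (\esum_(i in D) (c1 * a1 i + c2 * a2 i + c3 * a3 i + c4 * a4 i)%:E =
   (c1 * S1 + c2 * S2 + c3 * S3 + c4 * S4)%:E)%E.
Proof.
move=> [a10 a20 a30 a40] [c10 c20 c30 c40] [e1 e2 e3 e4].
rewrite !EFinD !EFinM -e1 -e2 -e3 -e4 -!esumZl//.
rewrite -!esumD// => i _;
  by rewrite -?EFinM -?EFinD lee_fin ?addr_ge0 ?mulr_ge0.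
Qed.

(* Let [j] be the only index in [D `&` C]; pairing the vanishing sum with the
   vector [a j] gives [|a j|^2 <= \sum_(i != j) |a j| |a i|].  Positive and
   negative parts are moved to opposite sides so that only sums of nonnegative
   families occur. *)
Lemma csum_eq0_le (R : realType) (I : choiceType) (D C : set I)
  (a : I -> R[i]) :
  (\esum_(i in D) (normc (a i))%:E < +oo)%E -> csum D a = 0 ->
  (forall i j, (D `&` C) i -> (D `&` C) j -> i = j) ->
  (\esum_(i in D `&` C) (normc (a i))%:E <=
   \esum_(i in D `&` ~` C) (normc (a i))%:E)%E.
Proof.
move=> afin a0 C1.
have n0 i : (0 <= (normc (a i))%:E)%E by rewrite lee_fin normc_ge0.
have E0 : (0 <= \esum_(i in D `&` ~` C) (normc (a i))%:E)%E.
  exact: esum_ge0.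
have [[j DCj]|nDC] := pselect (exists j, (D `&` C) j); last first.
  by rewrite esum1// => i DCi; case: nDC; exists i.
have -> : D `&` C = [set j].
  by apply/seteqP; split=> [i /C1|i ->//]; exact.
rewrite esum_set1//.
have [xfin yfin] : (\esum_(i in D) `|complex.Re (a i)|%:E < +oo)%E /\
    (\esum_(i in D) `|complex.Im (a i)|%:E < +oo)%E.
  by split; apply: le_lt_trans afin; apply: le_esum => i _;
    rewrite lee_fin ?normRe_le_normc ?normIm_le_normc.
pose x i := complex.Re (a i); pose y i := complex.Im (a i).
move: a0; rewrite /csum => -[].
move=> /(rsum_eq0 _ _ _ x xfin)[X Xp Xn] /(rsum_eq0 _ _ _ y yfin)[Y Yp Yn].
set N := normc (a j); pose p := complex.Re (a j); pose q := complex.Im (a j).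
pose pos (t : R) := Num.max t 0.
have posE t : t = pos t - pos (- t).
  by rewrite /pos !maxEle; case: ifPn; case: ifPn; rewrite -?ltNge; lra.
have pos0 t : 0 <= pos t by rewrite /pos le_max lexx orbT.
pose xp := x^\+; pose xn := x^\-; pose yp := y^\+; pose yn := y^\-.
have xE i : x i = xp i - xn i by exact: posE.
have yE i : y i = yp i - yn i by exact: posE.
have a40 : [/\ forall i, 0 <= xp i, forall i, 0 <= xn i, forall i, 0 <= yp i &
      forall i, 0 <= yn i].
  by split=> i; rewrite ?funrpos_ge0 ?funrneg_ge0.
(* The coefficient lists differ by exchanging the positive and negative parts of [p] and of [q].
   Since [xp] and [xn] both sum to [X], and [yp] and [yn] to [Y], the two combinations have equal
   finite sums, which cancel at the end. *)
have cneg : [/\ 0 <= pos (- p), 0 <= pos p, 0 <= pos (- q) & 0 <= pos q].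
  by split.
have cpos : [/\ 0 <= pos p, 0 <= pos (- p), 0 <= pos q & 0 <= pos (- q)].
  by split.
have Mneg := esum_lincomb4 _ _ D _ _ _ _ _ _ _ _ _ _ _ _
  a40 cneg (And4 Xp Xn Yp Yn).
have Mpos := esum_lincomb4 _ _ D _ _ _ _ _ _ _ _ _ _ _ _
  a40 cpos (And4 Xp Xn Yp Yn).
(* [v] carries the term [|a j|^2], and [w] the Cauchy-Schwarz bounds for the indices outside [C]. *)
pose v i : R := if i == j then N ^+ 2 else 0.
pose w i : R := if i \in C then 0 else N * normc (a i).
have v0 i : 0 <= v i by rewrite /v; case: ifP => //; rewrite sqr_ge0.
have w0 i : 0 <= w i.
  by rewrite /w; case: ifP => //; rewrite mulr_ge0 ?normc_ge0.
have vsum : (\esum_(i in D) (v i)%:E = (N ^+ 2)%:E)%E.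
  rewrite (esum_single _ _ _ j).
  - by rewrite /v eqxx.
  - by move=> i; rewrite lee_fin.
  - by case: DCj.
  - by move=> i _ ij; rewrite /v (negbTE ij).
have wsum : (\esum_(i in D) (w i)%:E =
    N%:E * \esum_(i in D `&` ~` C) (normc (a i))%:E)%E.
  rewrite esum_mkcondr -esumZl ?normc_ge0//; last by move=> i; case: ifP.
  apply: eq_esum => i _; rewrite /w in_setC.
  by case: (i \in C) => /=; rewrite ?mule0.
(* At [i = j] this is the identity [N ^+ 2 = p * x j + q * y j]; any other [i] in [D] lies outside
   [C], where Cauchy-Schwarz applies. *)
have vw i : D i ->
    v i + (pos (- p) * xp i + pos p * xn i + pos (- q) * yp i + pos q * yn i)
    <= w i + (pos p * xp i + pos (- p) * xn i + pos q * yp i +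
              pos (- q) * yn i).
  move=> Di; have : v i <= w i + (p * x i + q * y i).
    rewrite /v /w; case: eqVneq => [->|ij].
      rewrite mem_set; last by case: DCj.
      by rewrite /N sqr_normcE /x /y -/p -/q add0r -!expr2.
    rewrite memNset; last by move=> Ci; move/eqP: ij; apply; exact: C1.
    by rewrite -lerBlDr sub0r; exact: normc_Cauchy_Schwarz.
  rewrite xE yE [in X in X -> _](posE p) [in X in X -> _](posE q).
  lra.
have : (\esum_(i in D) ((v i)%:E + (pos (- p) * xp i + pos p * xn i +
    pos (- q) * yp i + pos q * yn i)%:E) <=
  \esum_(i in D) ((w i)%:E + (pos p * xp i + pos (- p) * xn i +
    pos q * yp i + pos (- q) * yn i)%:E))%E.
  by apply: le_esum => i Di; rewrite -!EFinD lee_fin; exact: vw.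
have lc0 c1 c2 c3 c4 i : 0 <= c1 -> 0 <= c2 -> 0 <= c3 -> 0 <= c4 ->
    0 <= c1 * xp i + c2 * xn i + c3 * yp i + c4 * yn i.
  by case: a40 => *; rewrite !addr_ge0// mulr_ge0.
have ? i : D i -> (0 <= (v i)%:E)%E by rewrite lee_fin.
have ? i : D i -> (0 <= (w i)%:E)%E by rewrite lee_fin.
rewrite !esumD//; try by move=> i _; rewrite lee_fin lc0.
rewrite Mneg Mpos vsum wsum.
move: E0; case: (\esum_(i in D `&` ~` C) _)%E => [e| |] //; last first.
  by move=> _ _; exact: leey.
rewrite -EFinM -!EFinD !lee_fin => e0 le1.
have {le1} : N * N <= N * e by rewrite -expr2; lra.
have := normc_ge0 _ (a j); rewrite -/N le_eqVlt => /orP[/eqP <- //|N0].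
by rewrite ler_pM2l.
Qed.

(** An infinite positive or negative part has [fine] value 0, so the triangle inequality gives the
    bound in every case. *)
Lemma norm_rsum_le (R : realType) (I : choiceType) (D : set I) (a : I -> R) :
  (`|rsum D a|%:E <= \esum_(i in D) `|a i|%:E)%E.
Proof.
have fine_le_self (A : \bar R) : (0 <= A)%E -> ((fine A)%:E <= A)%E.
  by case: A => //= r _; exact: leey.
have p0 : (0 <= \esum_(i in D) (a^\+ i)%:E)%E.
  by apply: esum_ge0 => i _; rewrite lee_fin funrpos_ge0.
have n0 : (0 <= \esum_(i in D) (a^\- i)%:E)%E.
  by apply: esum_ge0 => i _; rewrite lee_fin funrneg_ge0.
rewrite (eq_esum (b := fun i => (a^\+ i)%:E + (a^\- i)%:E)%E); last first.
  by move=> i _; rewrite -EFinD; have /(congr1 (@^~ i)) /= <- := funrposDneg a.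
rewrite esumD; [|by move=> i _; rewrite lee_fin funrpos_ge0
  |by move=> i _; rewrite lee_fin funrneg_ge0].
apply: le_trans (leeD (fine_le_self _ p0) (fine_le_self _ n0)).
rewrite -EFinD lee_fin /rsum; apply: le_trans (ler_normB _ _) _.
by rewrite !ger0_norm ?fine_ge0.
Qed.

Lemma measurable_normc (R : realType) d (T : measurableType d) (f : T -> R[i]) :
  measurable_fun setT (fun x => complex.Re (f x)) ->
  measurable_fun setT (fun x => complex.Im (f x)) ->
  measurable_fun setT (fun x => normc (f x)).
Proof.
move=> mRe mIm.
rewrite (_ : (fun x => _) = fun x =>
    Num.sqrt (complex.Re (f x) ^+ 2 + complex.Im (f x) ^+ 2)).
  apply: (@measurable_comp _ _ _ _ _ _ setT (@Num.sqrt R)) => //.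
    by apply: continuous_measurable_fun; exact: sqrt_continuous.
  by apply: measurable_funD; exact: measurable_funX.
by apply/funext => x; case: (f x).
Qed.

(** * Integrability and nonvanishing of the Poincaré series *)

Theorem theorem5p3 (R : realType) (G : topologicalGroupType)
  (G_locally_compact : locally_compact [set: G])
  (G_hausdorff : hausdorff_space G)
  (G_second_countable : @second_countable G)
  (G_unimodular : unimodular R G)
  (muG : {measure set (borel G) -> \bar R})
  (muG_haar : haar muG)
  (Gamma : groupClosed G)
  (Gamma_discrete : discrete_subgroup Gamma)
  (muQ : {measure set (borel (left_quotient Gamma)) -> \bar R})
  (muQ_quotient : quotient_measure muG muQ)
  (phi : G -> R[i])
  (phi_L1 : L1 muG phi) :
  (exists C : set G,
    [/\ measurable (C : set (borel G)),
        (int_norm muG (~` C) phi < int_norm muG C phi)%E &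
        [set (c / d)%g | c in C & d in C] `&` [set` Gamma] = [set 1%g]]) ->
  L1_neq0 muQ (poincare_quotient phi).
Proof.
move=> [C [mC C1 C2]].
have [s [ms sK]] := borel_section Gamma G_second_countable Gamma_discrete.
have muG_fin : forall K : set G, compact K -> (muG K < +oo)%E.
  by case: muG_haar => -[].
pose S := @orbit_sum R G Gamma s.
have mS := @orbit_sum_measurable R G Gamma G_second_countable Gamma_discrete
  s ms.
have intS := integral_orbit_sum Gamma G_locally_compact G_hausdorff
  G_second_countable Gamma_discrete muG muQ muG_fin muQ_quotient s ms sK.
have [mRe mIm phi_fin] := phi_L1.
pose absphi : borel G -> \bar R := fun y => (normc (phi y))%:E.
have absphi0 y : (0 <= absphi y)%E by rewrite lee_fin normc_ge0.
have mabsphi : measurable_fun setT absphi.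
  by apply/measurable_EFinP; exact: measurable_normc.
have Sge0 (f : borel G -> \bar R) x : (forall y, 0 <= f y)%E -> (0 <= S f x)%E.
  by move=> f0; exact: esum_ge0.
have pqE := poincare_quotient_sectionE Gamma s sK phi.
have msum (f : borel G -> R) : measurable_fun setT f ->
    measurable_fun setT
      (fun x => rsum [set` Gamma] (fun gamma => f (gamma * s x)%g)).
  move=> mf; apply: measurable_funB.
    apply: (@measurable_comp _ _ _ _ _ _ setT (@fine R) _
      (S (fun y => (f^\+ y)%:E))) => //.
    by apply: mS => [|y]; [exact/measurable_EFinP/measurable_funrpos
      |rewrite lee_fin funrpos_ge0].
  apply: (@measurable_comp _ _ _ _ _ _ setT (@fine R) _
    (S (fun y => (f^\- y)%:E))) => //.
  by apply: mS => [|y]; [exact/measurable_EFinP/measurable_funrneg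
    |rewrite lee_fin funrneg_ge0].
have mpqRe : measurable_fun [set: borel (left_quotient Gamma)]
    (fun x => complex.Re (poincare_quotient phi x)).
  by under eq_fun do rewrite pqE; exact: (msum (fun y => complex.Re (phi y))).
have mpqIm : measurable_fun [set: borel (left_quotient Gamma)]
    (fun x => complex.Im (poincare_quotient phi x)).
  by under eq_fun do rewrite pqE; exact: (msum (fun y => complex.Im (phi y))).
have Sabs_fin : (\int[muQ]_x S absphi x < +oo)%E by rewrite intS.
split.
  split=> //; rewrite /int_norm.
  (* Real and imaginary parts are each bounded by the orbit sum of the modulus; the resulting factor
     2 is harmless for integrability. *)
  apply: (@le_lt_trans _ _ (\int[muQ]_x (S absphi x + S absphi x))%E).
    apply: ge0_le_integral => //.
    - by move=> x _; rewrite lee_fin normc_ge0.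
    - by apply/measurable_EFinP; exact: measurable_normc.
    - by apply: emeasurable_funD; exact: mS.
    - move=> x _; apply: (@le_trans _ _
          (`|complex.Re (poincare_quotient phi x)|%:E +
           `|complex.Im (poincare_quotient phi x)|%:E)%E).
        by rewrite -EFinD lee_fin normc_le_ReIm.
      rewrite pqE; apply: leeD; apply: le_trans (norm_rsum_le _ _ _ _) _;
        apply: le_esum => gamma _; rewrite lee_fin.
        exact: normRe_le_normc.
      exact: normIm_le_normc.
  rewrite ge0_integralD//; try by [exact: mS|move=> x _; exact: Sge0].
  exact: lte_add_pinfty.
move=> pq0.
have patch0 (A : set G) y : (0 <= (absphi \_ A) y)%E.
  by rewrite patchE; case: ifP.
have mpatch (A : set (borel G)) :
    measurable A -> measurable_fun setT (absphi \_ A).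
  move=> mA; apply/(measurable_restrictT _ _).1 => //.
  exact: measurable_funTS.
have mCc := mpatch _ (measurableC mC).
have {}mC := mpatch _ mC.
(* Restricting the function to [A] amounts to restricting the sum to those [gamma] that move [s x]
   into [A], which is the form required by [csum_eq0_le]. *)
have Spatch (A : set G) x : S (absphi \_ A) x =
    (\esum_(gamma in [set` Gamma] `&` [set gamma | A (gamma * s x)%g])
      (normc (phi (gamma * s x)%g))%:E)%E.
  rewrite esum_mkcondr; apply: eq_esum => gamma _; rewrite patchE.
  by congr (if _ then _ else _); apply/idP/idP; rewrite !inE.
have : (int_norm muG C phi <= int_norm muG (~` C) phi)%E.
  have E (A : set (borel G)) : measurable_fun setT (absphi \_ A) ->
      int_norm muG A phi = (\int[muQ]_x S (absphi \_ A) x)%E.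
    by move=> mA; rewrite intS// /int_norm integral_mkcond.
  rewrite !E//.
  apply: ae_ge0_le_integral => //; try by move=> x _; exact: Sge0.
  - exact: mS.
  - exact: mS.
  - have Sint : muQ.-integrable setT (S absphi).
      apply/integrableP; split; first exact: mS.
      by under eq_integral do rewrite gee0_abs ?Sge0//.
    have := integrable_ae measurableT Sint; apply: filterS2 pq0 => x pq0 Sx _.
    rewrite !Spatch; apply: csum_eq0_le.
    + have Sx' : S absphi x \is a fin_num by exact: Sx.
      by rewrite -ge0_fin_numE//; exact: (Sge0 absphi x absphi0).
    + by rewrite -pqE.
    + move=> g1 g2 [/= g1G Cg1] [/= g2G Cg2]; apply: divg1_eq.
      (* If [g1] and [g2] both move [s x] into [C], then [g1 / g2] is the quotient of two points of
         [C] and lies in [Gamma], hence is 1 by (C2). *)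
      have : ([set (c / d)%g | c in C & d in C] `&` [set` Gamma]) (g1 / g2)%g.
        split; last exact: gpredF.
        exists (g1 * s x)%g => //; exists (g2 * s x)%g => //.
        by rewrite invgM mulgA mulgK.
      by rewrite C2.
by rewrite leNgt C1.
Qed.
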